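(* Consider the following two-player zero-sum recursive game in which both players are in the dark. States: $X=\{s_1,s_2,s_3,0^*,1^*,-1^*,2^*,-2^*\}$; actions of player 1: $I=\{T,B\}$; actions of player 2: $J=\{L,R\}$. The states $k^*$ ($k\in\{0,1,-1,2,-2\}$) are absorbing with stage payoff $k$; the stage payoff in $s_1,s_2,s_3$ is $0$. Transitions: - in $s_1$: if player 2 plays $L$ the state stays $s_1$, if player 2 plays $R$ the state moves to $-2^*$ (whatever player 1 plays); - in $s_2$: $(T,L)$ leads to $s_2$; $(T,R)$ leads to $-1^*$ with probability $1/2$ and to $s_3$ with probability $1/2$; $(B,L)$ leads to $1^*$ with probability $1/2$ and to $s_1$ with probability $1/2$; $(B,R)$ leads to $0^*$; - in $s_3$: if player 1 plays $T$ the state stays $s_3$, if player 1 plays $B$ the state moves to $2^*$ (whatever player 2 plays). Then the game which starts in $s_2$ has no limsup value: $\underline v^*=-\tfrac12<\tfrac12=\overline v^*$.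
   Context: The initial state $s_2$ is fixed and known. At each stage $n\ge1$ the players independently choose $i_n\in I$ and $j_n\in J$, the stage payoff (paid to player 1) is $g(x_n,i_n,j_n)$ and the next state $x_{n+1}$ is drawn from the transition. ''In the dark'' means that the players observe neither the state nor the action played by the other player (each player remembers only his own past actions); i.e. all signals are trivial. A behavioral strategy of player 1 is a sequence $\sigma=(\sigma_n)_{n\ge1}$ with $\sigma_n:I^{n-1}\to\Delta(I)$, of player 2 a sequence $\tau=(\tau_n)_{n\ge1}$ with $\tau_n:J^{n-1}\to\Delta(J)$. $\mathbb E_{\sigma,\tau}$ is the expectation for the induced probability on plays. With the limsup evaluation $\gamma^*(h)=\limsup_n g(x_n,i_n,j_n)$, $\underline v^*=\sup_\sigma\inf_\tau\mathbb E_{\sigma,\tau}(\gamma^* )$ and $\overline v^*=\inf_\tau\sup_\sigma\mathbb E_{\sigma,\tau}(\gamma^* )$; the limsup value exists if these are equal. *)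

(* Defs.v *)
From HB Require Import structures.
From mathcomp Require Import all_boot all_order all_algebra.
From mathcomp Require Import all_classical all_reals all_analysis.

Set Implicit Arguments.
Unset Strict Implicit.
Unset Printing Implicit Defensive.

Import Order.TTheory GRing.Theory Num.Theory.

Local Open Scope classical_set_scope.
Local Open Scope ring_scope.

(* The measurable types of the library are pointed, whence this structure. *)
#[short(type="finPointedType")]
HB.structure Definition FinPointed := {T of Finite T & Pointed T}.
HB.instance Definition _ (A B : finPointedType) := Pointed.on (A * B)%type.

Record dist (R : realType) (A : finType) := Dist {
  pmf :> A -> R;
  pmf_ge0 : forall a, 0 <= pmf a;
  pmf_sum1 : \sum_a pmf a = 1 }.

Lemma dirac_pmf_ge0 (R : realType) (A : finType) (a b : A) :
  0 <= (b == a)%:R :> R.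
Proof. exact: ler0n. Qed.

Lemma dirac_pmf_sum1 (R : realType) (A : finType) (a : A) :
  \sum_(b : A) (b == a)%:R = 1 :> R.
Proof.
by rewrite (bigD1 a)//= eqxx big1 ?addr0// => b /negbTE ->.
Qed.

Definition dirac_dist (R : realType) (A : finType) (a : A) : dist R A :=
  Dist (dirac_pmf_ge0 R a) (dirac_pmf_sum1 R a).

Lemma half_pmf_ge0 (R : realType) (A : finType) (a b c : A) :
  0 <= ((c == a)%:R + (c == b)%:R) / 2 :> R.
Proof. by rewrite divr_ge0// addr_ge0. Qed.

Lemma half_pmf_sum1 (R : realType) (A : finType) (a b : A) :
  \sum_(c : A) ((c == a)%:R + (c == b)%:R) / 2 = 1 :> R.
Proof.
by rewrite -mulr_suml big_split/= !dirac_pmf_sum1 divff// pnatr_eq0.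
Qed.

Definition half_dist (R : realType) (A : finType) (a b : A) : dist R A :=
  Dist (half_pmf_ge0 R a b) (half_pmf_sum1 R a b).

Section path_space.
Variable A : finPointedType.

Definition cylinder (h : seq A) : set (nat -> A) :=
  [set w | mkseq w (size h) = h].

Lemma cylinderI (h h' : seq A) :
  (range cylinder `|` [set set0]) (cylinder h `&` cylinder h').
Proof.
wlog : h h' / (size h <= size h')%N => [H|hh'].
  have [|/ltnW] := leqP (size h) (size h'); first exact: H.
  by move=> hh; rewrite setIC; exact: H.
have tk (w : nat -> A) : take (size h) (mkseq w (size h')) = mkseq w (size h).
  by rewrite /mkseq -map_take take_iota (minn_idPl hh').
have [e|ne] := eqVneq (take (size h) h') h.
  left; exists h' => //; apply/seteqP; split => w; rewrite /cylinder/=.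
    by move=> wh'; split=> //; rewrite -tk wh'.
  by case.
right; apply/seteqP; split => w //; rewrite /cylinder/= => -[wh wh'].
by move: ne; rewrite -[in X in take _ X]wh' tk wh eqxx.
Qed.

Definition paths : Type := g_sigma_algebraType (range cylinder).
HB.instance Definition _ := Measurable.on paths.

Lemma measurable_cylinder (h : seq A) : measurable (cylinder h : set paths).
Proof. by apply: sub_sigma_algebra; exists h. Qed.

End path_space.

Section path_measure.
Variables (R : realType) (A : finPointedType) (K : seq A -> dist R A).

Definition cylinder_weight (h : seq A) : R :=
  \prod_(k < size h) K (take k h) (nth point h k).

Let W := cylinder_weight.

Let W_rcons h a : W (rcons h a) = W h * K h a.
Proof.
rewrite /W /cylinder_weight size_rcons big_ord_recr/=.
rewrite -cats1 take_size_cat// nth_cat ltnn subnn/=; congr (_ * _).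
apply: eq_bigr => k _; rewrite nth_cat ltn_ord takel_cat//.
exact: ltnW (ltn_ord k).
Qed.

Let W_ge0 h : 0 <= W h.
Proof. by apply: prodr_ge0 => k _; exact: pmf_ge0. Qed.

Let C h n : R := \sum_(b | (enum_rank b < n)%N) K h b.

Let C0 h : C h 0 = 0.
Proof. by rewrite /C big_pred0. Qed.

Let C1 h : C h #|A| = 1.
Proof.
by rewrite -[RHS](pmf_sum1 (K h)) /C; apply: eq_bigl => b; rewrite ltn_ord.
Qed.

Let CS h a : C h (enum_rank a).+1 = C h (enum_rank a) + K h a.
Proof.
rewrite /C (bigD1 a)//= addrC; congr (_ + _); apply: eq_bigl => b.
rewrite ltnS [RHS]ltn_neqAle andbC; congr (_ && _).
by rewrite -(inj_eq enum_rank_inj).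
Qed.

Let C_mono h m n : (m <= n)%N -> C h m <= C h n.
Proof.
move=> mn; rewrite /C [leRHS](bigID (fun b => (enum_rank b < m)%N))/=.
rewrite -[leLHS]addr0 lerD//; last by apply: sumr_ge0 => b _; exact: pmf_ge0.
rewrite le_eqVlt; apply/orP; left; apply/eqP; apply: eq_bigl => b.
by apply/idP/andP => [bm|[]//]; split=> //; exact: leq_trans mn.
Qed.

Let L (h : seq A) : R :=
  \sum_(k < size h) W (take k h) * C (take k h) (enum_rank (nth point h k)).

Let L_rcons h a : L (rcons h a) = L h + W h * C h (enum_rank a).
Proof.
rewrite /L size_rcons big_ord_recr/=.
rewrite -cats1 take_size_cat// nth_cat ltnn subnn/=; congr (_ + _).
apply: eq_bigr => k _; rewrite nth_cat ltn_ord takel_cat//.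
exact: ltnW (ltn_ord k).
Qed.

(* Subdividing [0, 1[ into nested intervals J h of length W h, one for each
   finite sequence h, turns a uniform point of [0, 1[ into a random path. *)
Let J h (u : R) := (L h <= u < L h + W h).

Let J0 u : J [::] u = (0 <= u < 1).
Proof. by rewrite /J /L /W /cylinder_weight !big_ord0 add0r. Qed.

Let J_rcons h a u : J (rcons h a) u =
  (L h + W h * C h (enum_rank a) <= u < L h + W h * C h (enum_rank a).+1).
Proof. by rewrite /J L_rcons W_rcons CS mulrDr addrA. Qed.

Let J_sub h a u : J (rcons h a) u -> J h u.
Proof.
rewrite J_rcons /J => /andP[lu ul]; apply/andP; split.
  apply: le_trans lu; rewrite lerDl mulr_ge0//.
  by rewrite -(C0 h) C_mono.
apply: (lt_le_trans ul); rewrite lerD2l -[leRHS]mulr1 ler_wpM2l//.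
by rewrite -(C1 h) C_mono.
Qed.

Let J_ex h u : J h u -> exists a, J (rcons h a) u.
Proof.
move=> /andP[lu ul].
pose f n := L h + W h * C h n.
have [n nA /andP[fu uf]] :
    exists2 n, (n < #|A|)%N & f n <= u < f n.+1.
  have : f 0%N <= u < f #|A| by rewrite /f C0 C1 mulr0 mulr1 addr0 lu.
  elim: #|A| => [/andP[a b]|n IH /andP[a b]].
    by have := le_lt_trans a b; rewrite ltxx.
  have [fnu|ufn] := leP (f n) u; first by exists n => //; rewrite fnu.
  have [|m mn fm] := IH; first by rewrite a.
  by exists m => //; exact: ltnW.
have nA' : (n < #|{: A}|)%N by [].
exists (enum_val (Ordinal nA')); rewrite J_rcons enum_valK/=.
by rewrite -/(f n) -/(f n.+1) fu.
Qed.

Let J_uniq h a b u : J (rcons h a) u -> J (rcons h b) u -> a = b.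
Proof.
wlog : a b / (enum_rank a <= enum_rank b)%N.
  move=> H; have [|/ltnW] := leqP (enum_rank a) (enum_rank b); first exact: H.
  by move=> ba ha hb; apply/esym/H.
rewrite leq_eqVlt => /orP[/eqP/val_inj/enum_rank_inj//|ab].
rewrite !J_rcons => /andP[_ ua] /andP[bu _].
have : u < u.
  apply: (lt_le_trans ua); apply: le_trans bu.
  by rewrite lerD2l ler_wpM2l// C_mono.
by rewrite ltxx.
Qed.

Let prefix (u : R) := fix prefix n := if n is m.+1 then
  rcons (prefix m) (odflt point [pick a | J (rcons (prefix m) a) u]) else [::].

Let size_prefix u n : size (prefix u n) = n.
Proof. by elim: n => //= n IH; rewrite size_rcons IH. Qed.

Let phi u n : A := nth point (prefix u n.+1) n.

Let mkseq_phi u n : mkseq (phi u) n = prefix u n.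
Proof.
elim: n => //= n IH.
rewrite /mkseq -addn1 iotaD map_cat -/(mkseq _ _) IH add0n/=.
by rewrite cats1 /phi/= nth_rcons size_prefix ltnn eqxx.
Qed.

Let prefixP u h : 0 <= u < 1 -> J h u <-> prefix u (size h) = h.
Proof.
move=> u01; elim/last_ind: h => [|h a IH]; first by rewrite J0 u01.
rewrite size_rcons/=; split=> [Ju|].
  have /IH -> := J_sub Ju; congr rcons.
  by case: pickP => [b /J_uniq /(_ Ju)//|/(_ a)]; rewrite Ju.
move=> /rcons_inj[ph]; rewrite ph => ha.
have /J_ex[b Jb] : J h u by apply/IH.
by move: ha; case: pickP => [c Jc /= <-//|/(_ b)]; rewrite Jb.
Qed.

Let psi (u : R) : paths A := if 0 <= u < 1 then phi u else phi 0.

Let psi_cylinder h : psi @^-1` cylinder h `&` `[0, 1[ =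
  `[L h, (L h + W h)[%classic.
Proof.
apply/seteqP; split => u /=; rewrite /cylinder !in_itv/=.
  by move=> [+ u01]; rewrite /psi u01 mkseq_phi => /prefixP; exact.
move=> Ju.
have u01 : 0 <= u < 1.
  by rewrite -J0; elim/last_ind: h Ju => // h a IH /J_sub.
by split => //; rewrite /psi u01 mkseq_phi; apply/prefixP.
Qed.

Let measurable_psi : measurable_fun [set: R] psi.
Proof.
apply: (@measurability _ _ _ _ _ psi (range (@cylinder A))) => //.
move=> _ [_ [h _ <-] <-]; rewrite setTI.
rewrite -[X in measurable X](setUIDK _ `[0%R, 1%R[%classic).
apply: measurableU; first by rewrite psi_cylinder; exact: measurable_itv.
have [ph|ph] := pselect (cylinder h (phi 0)).
  suff -> : psi @^-1` cylinder h `\` `[0, 1[ = ~` `[0, 1[.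
    by apply: measurableC; exact: measurable_itv.
  apply/seteqP; split => u /=; rewrite in_itv/=; first by case.
  by move=> u01; split=> //; rewrite /psi; case: ifPn.
suff -> : psi @^-1` cylinder h `\` `[0, 1[ = set0 by [].
apply/seteqP; split => u //=; rewrite in_itv/= /psi => -[].
by case: ifPn.
Qed.

Let psi_mixin := isMeasurableFun.Build _ _ _ _ psi measurable_psi.
Let mpsi : {mfun R >-> paths A} := HB.pack psi psi_mixin.

Let m01 : measurable (`[0, 1[%classic : set R).
Proof. exact: measurable_itv. Qed.

Let pm : set (paths A) -> \bar R :=
  pushforward (mrestr (@lebesgue_measure R) m01) mpsi.

Let pm0 : pm set0 = 0%E.
Proof. exact: measure0. Qed.

Let pm_ge0 B : (0 <= pm B)%E.
Proof. exact: measure_ge0. Qed.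

Let pm_sigma_additive : semi_sigma_additive pm.
Proof. exact: measure_semi_sigma_additive. Qed.

HB.instance Definition _ := isMeasure.Build _ _ _ pm
  pm0 pm_ge0 pm_sigma_additive.

Let pm_setT : pm setT = 1%E.
Proof.
rewrite /pm /pushforward/= /mrestr preimage_setT setTI lebesgue_measure_itv/=.
by rewrite lte_fin ltr01 sube0.
Qed.

HB.instance Definition _ := Measure_isProbability.Build _ _ _ pm pm_setT.

Lemma path_measure_exists : exists P : probability (paths A) R,
  forall h, P (cylinder h) = (cylinder_weight h)%:E.
Proof.
exists pm => h; rewrite /= /pm /pushforward/= /mrestr psi_cylinder.
rewrite lebesgue_measure_itv/= lte_fin ltrDl lt_neqAle W_ge0 andbT eq_sym.
case: eqVneq => [W0|_]; first by rewrite -/(W h) W0.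
by rewrite -EFinB addrAC subrr add0r.
Qed.

(* The law of a random sequence whose next term, given that its first terms
   form the list h, is distributed according to K h. *)
Definition path_measure : probability (paths A) R :=
  sval (cid path_measure_exists).

Lemma path_measure_cylinder h :
  path_measure (cylinder h) = (cylinder_weight h)%:E.
Proof. exact: (svalP (cid path_measure_exists)). Qed.

Lemma path_measure_unique (P : probability (paths A) R) :
  (forall h, P (cylinder h) = (cylinder_weight h)%:E) ->
  forall B, measurable B -> P B = path_measure B.
Proof.
move=> PW B mB.
pose G : set (set (paths A)) := range (@cylinder A) `|` [set set0].
apply: (measure_unique G (fun=> setT)) => //.
- apply/seteqP; split; apply: smallest_sub.
  + exact: smallest_sigma_algebra.
  + by move=> X rX; apply: sub_sigma_algebra; left.
  + exact: smallest_sigma_algebra.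
  + by move=> X [rX|->]; [exact: sub_sigma_algebra|exact: sigma_algebra0].
- move=> X Y [[h _ <-]|->]; last by rewrite set0I; right.
  move=> [[h' _ <-]|->]; last by rewrite setI0; right.
  exact: cylinderI.
- by move=> _; left; exists [::] => //; apply/seteqP; split.
- by rewrite bigcup_const.
- move=> X [[h _ <-]|->]; last by rewrite !measure0.
  exact: (etrans (PW h) (esym (path_measure_cylinder h))).
- by move=> _; exact: le_lt_trans (probability_le1 P measurableT) (ltry 1).
Qed.

End path_measure.

Section games.
Variables (R : realType) (X I J : finPointedType).

Record game := Game {
  payoff : X -> I -> J -> R;
  transition : X -> I -> J -> dist R X }.

(* Players in the dark: a player only remembers his own past actions. The law
   of the action of stage n is the value of the strategy at the list, of length
   n - 1 and in chronological order, of the actions he has played so far. *)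
Definition dark_strategy (A : finType) := seq A -> dist R A.

Local Notation stage := (X * I * J)%type.

Variables (G : game) (x1 : X).

Definition state_law (h : seq stage) : dist R X :=
  if h is s :: h' then
    let: (x, i, j) := last s h' in transition G x i j
  else dirac_dist R x1.

Section strategies.
Variables (sigma : dark_strategy I) (tau : dark_strategy J).

Definition stage_pmf (h : seq stage) (s : stage) : R :=
  state_law h s.1.1 *
  (sigma [seq s'.1.2 | s' <- h] s.1.2 * tau [seq s'.2 | s' <- h] s.2).

Lemma stage_pmf_ge0 h s : 0 <= stage_pmf h s.
Proof. by rewrite !mulr_ge0// pmf_ge0. Qed.

Lemma stage_pmf_sum1 h : \sum_s stage_pmf h s = 1.
Proof.
rewrite -(pair_bigA_idem (addr0 0) (fun a j => stage_pmf h (a, j)))/=.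
rewrite -(pair_bigA_idem (addr0 0) (fun x i => \sum_j stage_pmf h (x, i, j)))/=.
rewrite -[RHS](pmf_sum1 (state_law h)); apply: eq_bigr => x _.
under eq_bigr => i _ do rewrite /stage_pmf/= -!mulr_sumr pmf_sum1 mulr1.
by rewrite -mulr_sumr pmf_sum1 mulr1.
Qed.

Definition stage_law (h : seq stage) : dist R stage :=
  Dist (stage_pmf_ge0 h) (stage_pmf_sum1 h).

(* A play w lists the triples (state, action of player 1, action of player 2);
   w n is the one of stage n + 1. *)
Definition play_prob : probability (paths stage) R := path_measure stage_law.

Definition limsup_payoff (w : paths stage) : \bar R :=
  limn_esup (fun n => (payoff G (w n).1.1 (w n).1.2 (w n).2)%:E).

Definition expected_payoff : \bar R :=
  (\int[play_prob]_w limsup_payoff w)%E.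

End strategies.

Definition limsup_maxmin : \bar R :=
  ereal_sup (range (fun sigma => ereal_inf (range (expected_payoff sigma)))).

Definition limsup_minmax : \bar R :=
  ereal_inf (range (fun tau =>
    ereal_sup (range (fun sigma => expected_payoff sigma tau)))).

Definition has_limsup_value : Prop := limsup_maxmin = limsup_minmax.

End games.

(* k* is written zk for k >= 0 and zmk for - k < 0. *)
Inductive state := s1 | s2 | s3 | z0 | z1 | zm1 | z2 | zm2.
Inductive row := Top | Bottom.
Inductive column := Left | Right.

Definition nat_of_state (x : state) : nat :=
  match x with
  | s1 => 0 | s2 => 1 | s3 => 2 | z0 => 3
  | z1 => 4 | zm1 => 5 | z2 => 6 | zm2 => 7
  end.
Definition ord_of_state (x : state) : 'I_8 := inord (nat_of_state x).
Definition state_of_ord (n : 'I_8) : state :=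
  nth s1 [:: s1; s2; s3; z0; z1; zm1; z2; zm2] n.
Lemma ord_of_stateK : cancel ord_of_state state_of_ord.
Proof. by case; rewrite /state_of_ord inordK. Qed.
HB.instance Definition _ := Finite.copy state (can_type ord_of_stateK).
HB.instance Definition _ := isPointed.Build state s2.

Definition bool_of_row (i : row) : bool := if i is Top then true else false.
Definition row_of_bool (b : bool) : row := if b then Top else Bottom.
Lemma bool_of_rowK : cancel bool_of_row row_of_bool.
Proof. by case. Qed.
HB.instance Definition _ := Finite.copy row (can_type bool_of_rowK).
HB.instance Definition _ := isPointed.Build row Top.

Definition bool_of_column (j : column) : bool :=
  if j is Left then true else false.
Definition column_of_bool (b : bool) : column := if b then Left else Right.
Lemma bool_of_columnK : cancel bool_of_column column_of_bool.
Proof. by case. Qed.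
HB.instance Definition _ := Finite.copy column (can_type bool_of_columnK).
HB.instance Definition _ := isPointed.Build column Left.

Definition recursive_payoff (R : realType) (x : state) (_ : row)
    (_ : column) : R :=
  match x with
  | s1 | s2 | s3 | z0 => 0
  | z1 => 1
  | zm1 => - 1
  | z2 => 2
  | zm2 => - 2
  end.

Definition recursive_transition (R : realType) (x : state) (i : row)
    (j : column) : dist R state :=
  match x, i, j with
  | s1, _, Left => dirac_dist R s1
  | s1, _, Right => dirac_dist R zm2
  | s2, Top, Left => dirac_dist R s2
  | s2, Top, Right => half_dist R zm1 s3
  | s2, Bottom, Left => half_dist R z1 s1
  | s2, Bottom, Right => dirac_dist R z0
  | s3, Top, _ => dirac_dist R s3
  | s3, Bottom, _ => dirac_dist R z2
  | k, _, _ => dirac_dist R k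
  end.

Definition recursive_game (R : realType) : game R state row column :=
  Game (@recursive_payoff R) (@recursive_transition R).

(* Main.v *)
Require Import Defs.
From mathcomp Require Import all_boot all_order all_algebra.
From mathcomp Require Import all_classical all_reals all_analysis.
From mathcomp Require Import measurable_realfun.
From mathcomp Require Import lra.

Set Implicit Arguments.
Unset Strict Implicit.
Unset Printing Implicit Defensive.

Import Order.TTheory GRing.Theory Num.Theory.
Import Defs.

Local Open Scope classical_set_scope.
Local Open Scope ring_scope.

(** From s2, only the first stage a at which player 1 plays Bottom and the first
    stage b at which player 2 plays Right matter. If a < b, the state moves to
    1* or s1 with equal probabilities and, from s1, player 2 moves to -2* as
    soon as he plays Right: the expected payoff is - 1/2 if b is finite.
    Symmetrically, if b < a, it is 1/2 when a is finite and - 1/2 when player 1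
    never plays Bottom. Hence the player who moves later wins, if he does move:
    against a known strategy, the other player waits until his opponent has
    almost surely moved, if he ever will, and moves then.

    The payoff of stage n is 0 until absorption, so almost every play has
    eventually constant payoffs, and dominated convergence turns the expected
    limsup payoff into the limit of the mean payoffs of the stages
    ([mean_payoff_cvg]). The latter are finite sums, which a supersolution, a
    function of the state and of the past actions that dominates the final
    payoff and does not increase on average, bounds by its value at the
    beginning ([mean_payoff_le]). Two supersolutions suffice.
    - [ceiling] depends on the state alone and shows that every pair of
      strategies yields at most 1/2.
    - [wait_bound] shows that, against a given strategy of player 1, waiting N
      stages before playing Right yields at most - 1/2 plus the probability
      that the first Bottom comes at a finite stage after the N first ones;
      this tends to 0 as N grows.

    Exchanging the players, with Top and Bottom renamed Left and Right and with
    k* and -k*, s1 and s3 swapped, changes the sign of the payoff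
    ([expected_payoff_mirror]); this yields the two opposite bounds. *)

(** * Finite-horizon means under the law of a random sequence *)

Section finite_horizon.
Variables (R : realType) (A : finPointedType).

Fixpoint histories (n : nat) : seq (seq A) :=
  if n is m.+1 then [seq rcons h a | h <- histories m, a <- enum A]
  else [:: [::]].

Lemma sum_histories0 (V : nmodType) (F : seq A -> V) :
  \sum_(h <- histories 0) F h = F [::].
Proof. by rewrite big_seq1. Qed.

Lemma sum_historiesS (V : nmodType) n (F : seq A -> V) :
  \sum_(h <- histories n.+1) F h =
  \sum_(h <- histories n) \sum_a F (rcons h a).
Proof.
by rewrite /= big_allpairs_dep; apply: eq_bigr => h _; rewrite big_enum.
Qed.

Lemma size_histories n h : h \in histories n -> size h = n.
Proof.
elim: n h => [|n IH] h /=; first by rewrite inE => /eqP ->.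
by case/allpairsP => -[h' a] /= [/IH <- _ ->]; rewrite size_rcons.
Qed.

Lemma mkseqSr (w : nat -> A) n : mkseq w n.+1 = rcons (mkseq w n) (w n).
Proof. by rewrite /mkseq -addn1 iotaD map_cat cats1. Qed.

(** A function of the first n terms is a finite combination of indicators of
    cylinders, which gives both its measurability and its integral. *)
Lemma history_decomposition n (F : seq A -> R) (w : paths A) :
  F (mkseq w n) = \sum_(h <- histories n) F h * \1_(cylinder h) w.
Proof.
have indicE m h : size h = m ->
    \1_(cylinder h) w = (mkseq w m == h)%:R :> R.
  move=> <-; rewrite indicE; congr ((_ : bool)%:R).
  by apply/idP/eqP; rewrite inE.
rewrite [RHS]big_seq (eq_bigr (fun h => F h * (mkseq w n == h)%:R)); last first.
  by move=> h /size_histories hn; rewrite (indicE n).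
rewrite -big_seq; elim: n F => [|n IH] F.
  by rewrite sum_histories0 eqxx mulr1.
rewrite sum_historiesS mkseqSr (IH (fun h => F (rcons h (w n)))).
apply: eq_bigr => h _; rewrite (bigD1 (w n))//= eqseq_rcons eqxx andbT.
rewrite big1 ?addr0// => a aw.
by rewrite eqseq_rcons (eq_sym _ a) (negbTE aw) andbF mulr0.
Qed.

Lemma measurable_history n (F : seq A -> R) :
  measurable_fun setT (fun w : paths A => F (mkseq w n)).
Proof.
rewrite (funext (history_decomposition n F)).
apply: measurable_sum => h; apply: measurable_funM => //.
by apply: measurable_indic; exact: measurable_cylinder.
Qed.

Variable K : seq A -> dist R A.

Definition mean n (F : seq A -> R) : R :=
  \sum_(h <- histories n) cylinder_weight K h * F h.

Lemma cylinder_weight_rcons h a :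
  cylinder_weight K (rcons h a) = cylinder_weight K h * K h a.
Proof.
rewrite /cylinder_weight size_rcons big_ord_recr/= -cats1 take_size_cat//.
rewrite nth_cat ltnn subnn/=; congr (_ * _); apply: eq_bigr => k _.
by rewrite nth_cat ltn_ord takel_cat// ltnW.
Qed.

Lemma cylinder_weight_ge0 h : 0 <= cylinder_weight K h.
Proof. by apply: prodr_ge0 => k _; exact: pmf_ge0. Qed.

Lemma mean0 F : mean 0 F = F [::].
Proof.
by rewrite /mean sum_histories0 /cylinder_weight big_ord0 mul1r.
Qed.

(** Conditioning on the first n terms. *)
Lemma meanS n F : mean n.+1 F = mean n (fun h => \sum_a K h a * F (rcons h a)).
Proof.
rewrite /mean sum_historiesS; apply: eq_bigr => h _; rewrite mulr_sumr.
by apply: eq_bigr => a _; rewrite cylinder_weight_rcons mulrA.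
Qed.

Lemma le_mean n F G : (forall h, size h = n -> F h <= G h) ->
  mean n F <= mean n G.
Proof.
move=> FG; rewrite /mean big_seq [leRHS]big_seq.
apply: ler_sum => h /size_histories hn.
by rewrite ler_wpM2l ?cylinder_weight_ge0 ?FG.
Qed.

Lemma integral_history n (F : seq A -> R) :
  (\int[path_measure K]_w (F (mkseq w n))%:E)%E = (mean n F)%:E.
Proof.
under eq_integral do rewrite history_decomposition -sumEFin.
have int h : (path_measure K).-integrable setT
    (fun w : paths A => (\1_(cylinder h) w : R)%:E).
  by apply: integrable_indic; exact: measurable_cylinder.
rewrite integral_sum//=; last first.
  by move=> h; exact: (integrableZl measurableT (F h) (int h)).
rewrite /mean -sumEFin; apply: eq_bigr => h _.
under eq_integral do rewrite EFinM.
rewrite integralZl// integral_indic//; last exact: measurable_cylinder.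
by rewrite setIT [X in (_ * X)%E]path_measure_cylinder -EFinM mulrC.
Qed.

(** A term that is impossible given the terms before it occurs at stage n with
    probability 0, and there are countably many stages. *)
Lemma ae_support : {ae path_measure K, forall w n, K (mkseq w n) (w n) != 0}.
Proof.
apply: ae_foralln => n.
pose F (h : seq A) : R := (K (take n h) (nth point h n) == 0)%:R.
pose B : set (paths A) := [set w | K (mkseq w n) (w n) = 0].
have BE w : \1_B w = F (mkseq w n.+1).
  rewrite indicE /F mkseqSr -cats1 take_size_cat ?size_mkseq//.
  rewrite nth_cat size_mkseq ltnn subnn/=; congr ((_ : bool)%:R).
  by apply/idP/eqP; rewrite inE.
have mB : measurable B.
  have -> : B = (fun w : paths A => F (mkseq w n.+1)) @^-1` [set 1].
    apply/seteqP; split=> w /=; rewrite -BE indicE.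
      by move=> Bw; rewrite mem_set.
    by case: (boolP (w \in B)) => [/set_mem//|_ /esym/eqP]; rewrite oner_eq0.
  rewrite -[X in measurable X]setTI.
  exact: measurable_history.
exists B; split=> //; last by move=> w /= /negP; rewrite negbK => /eqP.
rewrite -[B]setIT -integral_indic//.
under eq_integral do rewrite BE.
rewrite integral_history meanS /mean big_seq big1// => h /size_histories hn.
rewrite big1 ?mulr0// => a _.
have [->|Ka] := eqVneq (K h a) 0; first by rewrite mul0r.
rewrite /F -cats1 take_size_cat// nth_cat hn ltnn subnn/= (negbTE Ka).
by rewrite mulr0.
Qed.

End finite_horizon.

(** Renaming the terms of the sequence renames its law. *)
Lemma mean_rename (R : realType) (A : finPointedType)
    (K K' : seq A -> dist R A) (m : A -> A) (mK : involutive m) n F :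
  (forall h a, K' (map m h) (m a) = K h a) ->
  mean K' n F = mean K n (F \o map m).
Proof.
move=> KK'; elim: n F => [|n IH] F; first by rewrite !mean0.
rewrite !meanS IH; congr (mean K n _); apply/funext => h /=.
rewrite (reindex_inj (inv_inj mK)); apply: eq_bigr => a _.
by rewrite KK' map_rcons.
Qed.

(** * Mean stage payoffs of a game in the dark *)

Lemma sum_dist_le (R : realType) (B : finType) (p : dist R B) (f : B -> R) c :
  (forall b, f b <= c) -> \sum_b p b * f b <= c.
Proof.
move=> fc; rewrite -[leRHS]mul1r -(pmf_sum1 p) mulr_suml.
by apply: ler_sum => b _; rewrite ler_wpM2l ?pmf_ge0.
Qed.

Section dark_games.
Variables (R : realType) (X I J : finPointedType) (G : game R X I J) (x1 : X).

Local Notation stage := (X * I * J)%type.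

Definition stage_payoff (s : stage) : R := payoff G s.1.1 s.1.2 s.2.

(** This holds for recursive games, where nonzero payoffs occur in absorbing
    states only. *)
Definition payoffs_absorb := forall (s s' : stage), stage_payoff s != 0 ->
  transition G s.1.1 s.1.2 s.2 s'.1.1 != 0 -> stage_payoff s' = stage_payoff s.

Lemma state_law_rcons h (s : stage) :
  state_law G x1 (rcons h s) = transition G s.1.1 s.1.2 s.2.
Proof.
by case: h => [|s' h] /=; rewrite ?last_rcons; case: s => -[].
Qed.

Variables (sigma : dark_strategy R I) (tau : dark_strategy R J).

Local Notation K := (stage_law G x1 sigma tau).

(** Stages are numbered from 0, so that the payoff of stage n depends on a
    history of length n + 1, whose last element is the triple of stage n. *)
Definition mean_payoff n : R :=
  mean K n.+1 (fun h => stage_payoff (last point h)).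

Lemma integral_stage_payoff n :
  (\int[play_prob G x1 sigma tau]_w (stage_payoff (w n))%:E)%E =
  (mean_payoff n)%:E.
Proof.
rewrite -integral_history; apply: eq_integral => w _.
by rewrite mkseqSr last_rcons.
Qed.

(** Along almost every play the payoff is 0 forever, or constant from the first
    stage at which it is not 0. *)
Lemma ae_payoff_cvg : payoffs_absorb ->
  {ae play_prob G x1 sigma tau, forall w,
    (fun n => (stage_payoff (w n))%:E) @ \oo --> limsup_payoff G w}.
Proof.
move=> absorb.
have FF : Filter (nbhs (almost_everywhere (path_measure K))).
  exact: ae_filter_ringOfSetsType.
apply: filterS (ae_support K) => w support.
suff cvgw : cvgn (fun n => (stage_payoff (w n))%:E).
  by rewrite /limsup_payoff (is_cvg_limn_esupE cvgw).
have [[m gm]|] := pselect (exists m, stage_payoff (w m) != 0); last first.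
  move=> /forallNP g0; apply: (cvgP 0%E); apply: cvg_near_cst.
  by apply: nearW => n; have /negP := g0 n; rewrite negbK => /eqP ->.
apply: (cvgP (stage_payoff (w m))%:E); apply: cvg_near_cst.
exists m => // n /= /subnK <-; congr EFin.
elim: (n - m)%N => // k IH.
rewrite addSn -IH; apply: absorb; first by rewrite IH.
have : stage_pmf G x1 sigma tau (mkseq w (k + m).+1) (w (k + m).+1) != 0.
  exact: support.
rewrite mkseqSr /stage_pmf state_law_rcons; apply: contra_neq => ->.
by rewrite mul0r.
Qed.

Lemma mean_payoff_cvg : payoffs_absorb ->
  (fun n => (mean_payoff n)%:E) @ \oo --> expected_payoff G x1 sigma tau.
Proof.
move=> absorb.
have mg n : measurable_fun setT
    (fun w : paths stage => (stage_payoff (w n))%:E).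
  apply/measurable_EFinP.
  have -> : (fun w : paths stage => stage_payoff (w n)) =
    (fun w : paths stage => stage_payoff (last point (mkseq w n.+1))).
    by apply/funext => w; rewrite mkseqSr last_rcons.
  exact: (measurable_history n.+1 (fun h => stage_payoff (last point h))).
have FF : Filter (nbhs (almost_everywhere (play_prob G x1 sigma tau))).
  exact: ae_filter_ringOfSetsType.
pose M : R := \sum_s `|stage_payoff s|.
have [] := @dominated_convergence _ _ _ (play_prob G x1 sigma tau) setT
  measurableT (fun n w => (stage_payoff (w n))%:E) (limsup_payoff G)
  (EFin \o cst M) mg.
- exact: measurable_fun_limn_esup.
- by apply: filterS (ae_payoff_cvg absorb) => w.
- exact: finite_measure_integrable_cst.
- apply: nearW => w n _ /=; rewrite lee_fin /M (bigD1 (w n))//= lerDl.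
  by apply: sumr_ge0.
move=> _ _; rewrite /expected_payoff.
by under eq_fun do rewrite integral_stage_payoff.
Qed.

(** Phi x ih jh bounds the mean payoff of stage n given the current state x and
    the past actions ih and jh, by backward induction from stage n. *)
Definition is_supersolution n (Phi : X -> seq I -> seq J -> R) :=
  (forall x ih jh, size ih = n -> size jh = n -> forall i j,
     payoff G x i j <= Phi x ih jh) /\
  (forall x ih jh, (size ih < n)%N -> size jh = size ih ->
     \sum_i sigma ih i * (\sum_j tau jh j *
       \sum_y transition G x i j y * Phi y (rcons ih i) (rcons jh j))
     <= Phi x ih jh).

Lemma sum_stage_law h (F : stage -> R) :
  \sum_s K h s * F s = \sum_x state_law G x1 h x *
    \sum_i sigma [seq s.1.2 | s <- h] i *
      (\sum_j tau [seq s.2 | s <- h] j * F (x, i, j)).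
Proof.
pose f x i j := K h (x, i, j) * F (x, i, j).
rewrite (eq_bigr (fun s => f s.1.1 s.1.2 s.2)); last by case=> -[].
rewrite -(pair_bigA_idem (addr0 0) (fun a j => f a.1 a.2 j))/=.
rewrite -(pair_bigA_idem (addr0 0) (fun x i => \sum_j f x i j))/=.
apply: eq_bigr => x _; rewrite mulr_sumr; apply: eq_bigr => i _.
rewrite !mulr_sumr; apply: eq_bigr => j _.
by rewrite /f /= /stage_pmf/= !mulrA.
Qed.

(** The mean of Phi at the current state and past actions does not increase
    from one stage to the next, up to stage n, where it dominates the mean
    payoff. *)
Lemma mean_payoff_le n Phi : is_supersolution n Phi ->
  mean_payoff n <= Phi x1 [::] [::].
Proof.
move=> [Phi_ge Phi_super].
(* A history of length m ends with stage m - 1; its conditional law of the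
   state of stage m averages Phi over that state. *)
pose Z h := \sum_x state_law G x1 h x *
  Phi x [seq s.1.2 | s <- h] [seq s.2 | s <- h].
have Z_super m : (m <= n)%N -> mean K m Z <= Phi x1 [::] [::].
  elim: m => [|m IH] mn.
    rewrite mean0 /Z /= (bigD1 x1)//= eqxx mul1r big1 ?addr0// => x.
    by move=> /negbTE ->; rewrite mul0r.
  apply: le_trans (IH (ltnW mn)); rewrite meanS; apply: le_mean => h hm.
  rewrite sum_stage_law /Z; apply: ler_sum => x _.
  rewrite ler_wpM2l ?pmf_ge0//.
  apply: le_trans (Phi_super x _ _ _ _); rewrite ?size_map ?hm//.
  rewrite le_eqVlt; apply/orP; left; apply/eqP.
  apply: eq_bigr => i _; congr (_ * _); apply: eq_bigr => j _; congr (_ * _).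
  by apply: eq_bigr => y _; rewrite !map_rcons state_law_rcons.
apply: le_trans (Z_super n (leqnn n)).
rewrite /mean_payoff meanS; apply: le_mean => h hn.
under eq_bigr do rewrite last_rcons.
rewrite sum_stage_law; apply: ler_sum => x _.
rewrite ler_wpM2l ?pmf_ge0//.
apply: sum_dist_le => i; apply: sum_dist_le => j.
by apply: Phi_ge; rewrite size_map.
Qed.

End dark_games.

(** * The recursive game *)

Section the_game.
Variable R : realType.

Local Notation G := (recursive_game R).
Local Notation stage := (state * row * column)%type.

Lemma sum_row (V : nmodType) (F : row -> V) : \sum_i F i = F Top + F Bottom.
Proof.
rewrite (reindex row_of_bool) ?big_bool//.
by exists bool_of_row => [[]|[]].
Qed.

Lemma sum_dirac (B : finType) (a : B) (f : B -> R) :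
  \sum_b dirac_dist R a b * f b = f a.
Proof.
rewrite (bigD1 a)//= eqxx mul1r big1 ?addr0// => b /negbTE ->.
by rewrite mul0r.
Qed.

Lemma sum_half (B : finType) (a b : B) (f : B -> R) :
  \sum_c half_dist R a b c * f c = (f a + f b) / 2.
Proof.
rewrite -(sum_dirac a) -(sum_dirac b) -big_split/= mulr_suml.
by apply: eq_bigr => c _; rewrite -mulrDl mulrAC.
Qed.

Lemma sum_transition x i j (f : state -> R) :
  \sum_y transition G x i j y * f y =
  match x, i, j with
  | s1, _, Right => f zm2
  | s2, Top, Right => (f zm1 + f s3) / 2
  | s2, Bottom, Left => (f z1 + f s1) / 2
  | s2, Bottom, Right => f z0
  | s3, Bottom, _ => f z2
  | _, _, _ => f x
  end.
Proof. by case: x i j => [] [] []; rewrite ?sum_dirac ?sum_half. Qed.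

Lemma game_absorbs : payoffs_absorb G.
Proof.
have dirac_neq0 (x y : state) : dirac_dist R x y != 0 -> y = x.
  by rewrite /= pnatr_eq0 eqb0 negbK => /eqP.
move=> [[x i] j] [[y i'] j']; rewrite /stage_payoff /=.
by case: x => //=; rewrite ?eqxx// => _ /dirac_neq0 ->.
Qed.

Lemma expected_payoff_le sigma tau (b : R) m :
  (forall n, (m <= n)%N -> mean_payoff G s2 sigma tau n <= b) ->
  (expected_payoff G s2 sigma tau <= b%:E)%E.
Proof.
move=> le_b; have cvg := mean_payoff_cvg (x1 := s2) (sigma := sigma)
  (tau := tau) game_absorbs.
rewrite -(cvg_lim _ cvg)//; apply: lime_le; first exact: cvgP cvg.
by exists m => // n /= mn; rewrite lee_fin le_b.
Qed.

(** The best that player 1 can hope for: player 2 never plays Right in s1, and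
    player 1 always ends up playing Bottom in s3. *)
Definition ceiling (x : state) : R :=
  match x with
  | s1 => 0
  | s2 => 1 / 2
  | s3 => 2
  | k => recursive_payoff R k Top Left
  end.

Lemma expected_payoff_le_half sigma tau :
  (expected_payoff G s2 sigma tau <= (1 / 2)%:E)%E.
Proof.
apply: (@expected_payoff_le _ _ _ 0) => n _.
apply: (@mean_payoff_le _ _ _ _ _ _ _ _ _ (fun x _ _ => ceiling x)).
split=> [x ih jh _ _ i j|x ih jh _ _]; first by case: x => /=; lra.
apply: sum_dist_le => i; apply: sum_dist_le => j.
by rewrite sum_transition; case: x i j => [] [] [] /=; lra.
Qed.

Section waiting.
Variables (sigma : dark_strategy R row).

Definition top_prob k : R := sigma (nseq k Top) Top.

(** The probability that player 1, having played Top only before stage n, goes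
    on doing so until stage m excluded. *)
Definition patience n m : R := \prod_(n <= k < m) top_prob k.

Definition wait (N : nat) : dark_strategy R column :=
  fun jh => dirac_dist R (if (size jh < N)%N then Left else Right).

(** At the histories that occur with positive probability against [wait N],
    this bounds the expected payoff of stage M. In s3, player 1 earns 2 if he
    plays Bottom before stage M. In s2, at a stage n <= N, he loses 1/2 on
    average, except that he may win up to 1 more if his first Bottom comes at
    stage N or later but before stage M, which has probability
    patience n N - patience n M. The state s1 is reached at stage N at the
    latest, and then Right leads to -2*. The other histories have
    probability 0, and the values there are crude upper bounds. *)
Definition wait_bound N M (x : state) (ih : seq row) (_ : seq column) : R :=
  let n := size ih in
  let only_top := all (pred1 Top) ih in
  match x with
  | s1 => if (n <= N)%N then - 2 else 0
  | s2 => if (n <= N)%N && only_top then - (1 / 2) + patience n N - patience n M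
          else 2
  | s3 => if only_top then 2 * (1 - patience n M) else 2
  | k => recursive_payoff R k Top Left
  end.

(** Among the histories of positive probability, the inequality can be
    strict only at stage N in s2, where playing Bottom against Right yields 0 whereas the
    bound grants 1/2. *)
Lemma wait_boundP N M : (N < M)%N ->
  is_supersolution G sigma (wait N) M (wait_bound N M).
Proof.
move=> NM; split=> [x ih jh ihM _ i j|x ih jh ihM jhih].
  have NihF : (size ih <= N)%N = false by rewrite ihM leqNgt NM.
  by case: x => //=; rewrite ?NihF//= ihM /patience big_geq//; case: ifP; lra.
have sum1 : sigma ih Top + sigma ih Bottom = 1 by rewrite -sum_row pmf_sum1.
have Top_ge0 := pmf_ge0 (sigma ih) Top.
have Bot_ge0 := pmf_ge0 (sigma ih) Bottom.
rewrite sum_row /wait !sum_dirac jhih !sum_transition /wait_bound.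
rewrite !size_rcons !all_rcons /=.
have patience_ge0 n : 0 <= patience n M.
  by apply: prodr_ge0 => k _; exact: pmf_ge0.
have [T|/negbTE T] := boolP (all (pred1 Top) ih); last first.
  by rewrite !andbF; case: ifP => nN; case: x => //=; do ?case: ifP; lra.
have patienceE m : (size ih < m)%N ->
    patience (size ih) m = sigma ih Top * patience (size ih).+1 m.
  by move=> ?; rewrite /patience big_ltn// /top_prob -(all_pred1P _ _ T).
have ME := patienceE _ ihM.
have QM_ge0 : 0 <= sigma ih Top * patience (size ih).+1 M by rewrite mulr_ge0.
case: (ltngtP (size ih) N) => [nN|Nn|nN].
- have NE := patienceE _ nN.
  by case: x => /=; lra.
- by case: x => /=; lra.
- have NN : patience (size ih) N = 1 by rewrite nN /patience big_geq.
  by case: x => /=; lra.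
Qed.

(** The probability of playing Top only during the N first stages decreases to
    a limit; once it is within eps of it, player 1 plays his first Bottom later
    with probability at most eps. *)
Lemma wait_near_optimal eps : 0 < eps ->
  exists tau, (expected_payoff G s2 sigma tau <= (- (1 / 2) + eps)%:E)%E.
Proof.
move=> eps0; pose q := range (patience 0).
have q_lb : has_lbound q.
  by exists 0 => _ [n _ <-]; apply: prodr_ge0 => k _; exact: pmf_ge0.
have [] := inf_adherent eps0 (_ : has_inf q).
  by split=> //; exists (patience 0 0), 0%N.
move=> _ [N _ <-] qN; exists (wait N).
apply: (@expected_payoff_le _ _ _ N.+1) => M NM.
apply: (le_trans (mean_payoff_le s2 (wait_boundP NM))) => /=.
have : inf q <= patience 0 M by apply: ge_inf => //; exists M.
by move: qN; lra.
Qed.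

End waiting.

(** * Antisymmetry between the players *)

Definition column_of_row (i : row) : column := column_of_bool (bool_of_row i).
Definition row_of_column (j : column) : row := row_of_bool (bool_of_column j).

Definition mirror_state (x : state) : state :=
  match x with
  | s1 => s3 | s2 => s2 | s3 => s1 | z0 => z0
  | z1 => zm1 | zm1 => z1 | z2 => zm2 | zm2 => z2
  end.

Definition mirror (s : stage) : stage :=
  (mirror_state s.1.1, row_of_column s.2, column_of_row s.1.2).

Lemma mirrorK : involutive mirror.
Proof. by case=> -[[] []] []. Qed.

Lemma mirror_payoff s : stage_payoff G (mirror s) = - stage_payoff G s.
Proof. by case: s => -[[] i] j; rewrite /stage_payoff /= ?oppr0 ?opprK. Qed.

Lemma mirror_state_law h x :
  state_law G s2 (map mirror h) (mirror_state x) = state_law G s2 h x.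
Proof.
have mirror_stateK : involutive mirror_state by case.
have mirror_eq y : (mirror_state x == y) = (x == mirror_state y).
  by rewrite -(inj_eq (inv_inj mirror_stateK)) mirror_stateK.
elim/last_ind: h => [|h s _]; first by rewrite /= mirror_eq.
rewrite map_rcons !state_law_rcons.
by case: s => -[[] []] []; rewrite /= !mirror_eq.
Qed.

Section row_strategy.
Variable tau : dark_strategy R column.

Definition row_pmf ih i : R := tau (map column_of_row ih) (column_of_row i).

Lemma row_pmf_ge0 ih i : 0 <= row_pmf ih i.
Proof. exact: pmf_ge0. Qed.

Lemma row_pmf_sum1 ih : \sum_i row_pmf ih i = 1.
Proof.
rewrite -(pmf_sum1 (tau (map column_of_row ih))) (reindex column_of_row)//.
by exists row_of_column => [[]|[]].
Qed.

Definition row_strategy : dark_strategy R row :=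
  fun ih => Dist (row_pmf_ge0 ih) (row_pmf_sum1 ih).

End row_strategy.

(** Both players use strategies of player 2, the first one after renaming the
    actions; exchanging them reflects every history by [mirror]. *)
Lemma mean_payoff_mirror tau tau' n :
  mean_payoff G s2 (row_strategy tau) tau' n =
  - mean_payoff G s2 (row_strategy tau') tau n.
Proof.
rewrite /mean_payoff (mean_rename (K := stage_law G s2 (row_strategy tau') tau)
  mirrorK); last first.
  move=> h [[x i] j]; rewrite /= /stage_pmf/= mirror_state_law; congr (_ * _).
  rewrite /row_pmf mulrC -!map_comp; congr (_ * _).
  have row_columnK : cancel row_of_column column_of_row by case.
  rewrite row_columnK; congr (pmf (tau _) _); apply: eq_map => s /=.
  exact: row_columnK.
rewrite /mean -sumrN; apply: eq_bigr => h _; rewrite -mulrN; congr (_ * _).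
rewrite -mirror_payoff; congr stage_payoff.
exact: (last_map mirror h point).
Qed.

Lemma expected_payoff_mirror tau tau' :
  expected_payoff G s2 (row_strategy tau) tau' =
  (- expected_payoff G s2 (row_strategy tau') tau)%E.
Proof.
have cvg := mean_payoff_cvg (x1 := s2) (sigma := row_strategy tau)
  (tau := tau') game_absorbs.
have /cvgeN cvg' := mean_payoff_cvg (x1 := s2) (sigma := row_strategy tau')
  (tau := tau) game_absorbs.
apply: (cvg_unique _ cvg) => //.
have -> : (fun n => (mean_payoff G s2 (row_strategy tau) tau' n)%:E) =
    (fun n => - (mean_payoff G s2 (row_strategy tau') tau n)%:E)%E.
  by apply/funext => n; rewrite mean_payoff_mirror EFinN.
exact: cvg'.
Qed.

(** * The two values *)

Lemma limsup_maxminE : limsup_maxmin G s2 = (- (1 / 2))%:E.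
Proof.
(* Every strategy of player 1 guarantees - 1/2; the constant one is as good as any. *)
pose tau0 : dark_strategy R column := fun=> dirac_dist R Left.
apply/eqP; rewrite eq_le; apply/andP; split.
  apply/ereal_supP => _ [sigma _ <-]; apply/lee_addgt0Pr => eps eps0.
  have [tau le_tau] := wait_near_optimal sigma eps0.
  apply: ereal_inf_le; exists (expected_payoff G s2 sigma tau) => //.
apply: ereal_sup_ge.
exists (ereal_inf (range (expected_payoff G s2 (row_strategy tau0)))).
  by exists (row_strategy tau0).
apply/ereal_infP => _ [tau _ <-].
by rewrite expected_payoff_mirror EFinN leeN2 expected_payoff_le_half.
Qed.

Lemma limsup_minmaxE : limsup_minmax G s2 = (1 / 2)%:E.
Proof.
pose tau0 : dark_strategy R column := fun=> dirac_dist R Left.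
apply/eqP; rewrite eq_le; apply/andP; split.
  apply: ereal_inf_le.
  exists (ereal_sup (range (fun sigma => expected_payoff G s2 sigma tau0))).
    by exists tau0.
  by apply/ereal_supP => _ [sigma _ <-]; exact: expected_payoff_le_half.
apply/ereal_infP => _ [tau _ <-]; apply/lee_subgt0Pr => eps eps0.
have [tau' le_tau'] := wait_near_optimal (row_strategy tau) eps0.
apply: ereal_sup_ge; exists (expected_payoff G s2 (row_strategy tau') tau).
  by exists (row_strategy tau').
by rewrite expected_payoff_mirror leeNr -EFinB -EFinN opprB addrC.
Qed.

End the_game.

Theorem mainTheorem4 (R : realType) :
  [/\ ~ has_limsup_value (recursive_game R) s2,
      limsup_maxmin (recursive_game R) s2 = (- (1 / 2))%:E,
      limsup_minmax (recursive_game R) s2 = (1 / 2)%:E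
    & (limsup_maxmin (recursive_game R) s2 < limsup_minmax (recursive_game R) s2)%E].
Proof.
have lt_half : (- (1 / 2) < 1 / 2 :> R) by lra.
rewrite /has_limsup_value limsup_maxminE limsup_minmaxE; split=> //.
by move=> [] /eqP; rewrite lt_eqF.
Qed.
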